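(* Let $X\in\mathbb{R}^{m\times n_1}$ and $Y\in\mathbb{R}^{m\times n_2}$, and let $k$ be an integer with $1\le k\le \min\{m,n_1+n_2\}$. Let $\Sigma_k\in\mathbb{R}^{k\times k}$ be the diagonal matrix of the $k$ largest singular values (counted with multiplicity) of the block matrix $\begin{bmatrix} X & Y\end{bmatrix}\in\mathbb{R}^{m\times(n_1+n_2)}$, and let $U_k\in\mathbb{R}^{m\times k}$ and $V_k\in\mathbb{R}^{(n_1+n_2)\times k}$ contain as columns the left and right singular vectors of $\begin{bmatrix} X & Y\end{bmatrix}$, respectively, corresponding to those singular values. Then the function $$f(U,V,W)=\|X-UV^T\|_F^2+\|Y-UW^T\|_F^2,\qquad U\in\mathbb{R}^{m\times k},\ V\in\mathbb{R}^{n_1\times k},\ W\in\mathbb{R}^{n_2\times k},$$ attains its minimum over all such triples $(U,V,W)$ at $U=U_k$, $V$ equal to the first $n_1$ rows of $V_k\Sigma_k$, and $W$ equal to the remaining $n_2$ rows of $V_k\Sigma_k$.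
   Context: $\|\cdot\|_F$ denotes the Frobenius norm. The matrices $U_k,\Sigma_k,V_k$ come from a singular value decomposition $\begin{bmatrix} X & Y\end{bmatrix}=\widetilde U\Sigma \widetilde V^T$ with $\widetilde U\in\mathbb{R}^{m\times m}$ and $\widetilde V\in\mathbb{R}^{(n_1+n_2)\times(n_1+n_2)}$ orthogonal and singular values in non-increasing order: $U_k$ and $V_k$ consist of the first $k$ columns of $\widetilde U$ and $\widetilde V$, and $\Sigma_k$ is the leading $k\times k$ block of $\Sigma$. *)

(* Defs.v *)
From mathcomp Require Import all_boot all_order all_algebra.
From mathcomp Require Import reals.
Set Implicit Arguments.
Unset Strict Implicit.
Unset Printing Implicit Defensive.
Import Order.TTheory GRing.Theory Num.Theory.
Local Open Scope ring_scope.

Definition frobenius_norm (R : realType) (m n : nat) (A : 'M[R]_(m, n)) : R :=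
  Num.sqrt (\sum_(i < m) \sum_(j < n) A i j ^+ 2).

Definition orthogonal_mx (R : realType) (n : nat) (Q : 'M[R]_n) : Prop :=
  Q^T *m Q = 1%:M /\ Q *m Q^T = 1%:M.

(* S may be rectangular: its diagonal entries are the S i j with i and j equal
   as natural numbers, although i : 'I_m and j : 'I_n. *)
Definition singular_value_mx (R : realType) (m n : nat) (S : 'M[R]_(m, n)) :
    Prop :=
  [/\ forall (i : 'I_m) (j : 'I_n), i <> j :> nat -> S i j = 0,
      forall (i : 'I_m) (j : 'I_n), i = j :> nat -> 0 <= S i j
    & forall (i i' : 'I_m) (j j' : 'I_n),
        i = j :> nat -> i' = j' :> nat -> (i <= i')%N -> S i' j' <= S i j].

Definition is_svd (R : realType) (m n : nat) (A : 'M[R]_(m, n))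
    (U : 'M[R]_m) (S : 'M[R]_(m, n)) (V : 'M[R]_n) : Prop :=
  [/\ orthogonal_mx U, orthogonal_mx V, singular_value_mx S
    & A = U *m S *m V^T].

Definition first_cols (R : realType) (m n k : nat) (hk : (k <= n)%N)
    (A : 'M[R]_(m, n)) : 'M[R]_(m, k) :=
  colsub (widen_ord hk) A.

Definition leading_block (R : realType) (m n k : nat) (hkm : (k <= m)%N)
    (hkn : (k <= n)%N) (A : 'M[R]_(m, n)) : 'M[R]_k :=
  mxsub (widen_ord hkm) (widen_ord hkn) A.

Definition joint_error (R : realType) (m n1 n2 k : nat)
    (X : 'M[R]_(m, n1)) (Y : 'M[R]_(m, n2))
    (U : 'M[R]_(m, k)) (V : 'M[R]_(n1, k)) (W : 'M[R]_(n2, k)) : R :=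
  frobenius_norm (X - U *m V^T) ^+ 2 + frobenius_norm (Y - U *m W^T) ^+ 2.

(* Main.v *)
Require Import Defs.
From mathcomp Require Import all_boot all_order all_algebra.
From mathcomp Require Import reals.
From mathcomp Require Import lra.
Import Order.TTheory GRing.Theory Num.Theory.
Local Open Scope ring_scope.

(* Write A = [X Y], so that the objective is |A - B|^2 with B of rank at most k.
   By orthogonal invariance of the Frobenius norm, A may be replaced by S.  If P
   is the orthogonal projector onto a subspace of dimension at most k containing
   the columns of B, then |S - B|^2 >= |(1 - P) S|^2 = \sum_i (1 - P_ii) s_i^2,
   and since 0 <= P_ii <= 1 and \tr P <= k, this is at least the sum of the
   s_i^2 with i >= k, because the s_i are non-increasing. *)

(** * Squared Frobenius norm and its orthogonal invariance *)

Section SumOfSquares.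
Context {R : realType}.

Definition sumsq {m n : nat} (A : 'M[R]_(m, n)) : R :=
  \sum_(i < m) \sum_(j < n) A i j ^+ 2.

Lemma sumsq_ge0 {m n : nat} (A : 'M[R]_(m, n)) : 0 <= sumsq A.
Proof. by do 2!apply: sumr_ge0 => ? _; exact: sqr_ge0. Qed.

Lemma frobenius_norm_sqr {m n : nat} (A : 'M[R]_(m, n)) :
  frobenius_norm A ^+ 2 = sumsq A.
Proof. by rewrite sqr_sqrtr // sumsq_ge0. Qed.

Lemma sumsq_mxtrace {m n : nat} (A : 'M[R]_(m, n)) :
  sumsq A = \tr (A *m A^T).
Proof.
apply: eq_bigr => i _; rewrite mxE; apply: eq_bigr => j _.
by rewrite mxE expr2.
Qed.

Lemma sumsq_row_mx {m n1 n2 : nat} (A : 'M[R]_(m, n1)) (B : 'M[R]_(m, n2)) :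
  sumsq (row_mx A B) = sumsq A + sumsq B.
Proof.
by rewrite !sumsq_mxtrace tr_row_mx mul_row_col raddfD.
Qed.

Lemma sumsq_eq0 {m n : nat} (A : 'M[R]_(m, n)) : sumsq A = 0 -> A = 0.
Proof.
have row_ge0 i : 0 <= \sum_j A i j ^+ 2 by apply: sumr_ge0 => j _; exact: sqr_ge0.
move/(psumr_eq0P (fun i _ => row_ge0 i)) => h.
apply/matrixP => i j; rewrite mxE.
have /psumr_eq0P/(_ j isT)/eqP := h i isT.
by rewrite sqrf_eq0 => h'; apply/eqP/h' => ? _; exact: sqr_ge0.
Qed.

Lemma sumsq_orthogonal {m n : nat} (U : 'M[R]_m) (V : 'M[R]_n)
    (A : 'M[R]_(m, n)) :
  orthogonal_mx U -> orthogonal_mx V -> sumsq (U *m A *m V^T) = sumsq A.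
Proof.
move=> [UU _] [VV _]; rewrite !sumsq_mxtrace !trmx_mul trmxK.
rewrite -!mulmxA (mulmxA V^T V) VV mul1mx mxtrace_mulC -!mulmxA UU mulmx1.
by [].
Qed.

End SumOfSquares.

(** * Orthogonal projectors *)

Section Projector.
Context {R : realType}.

(** If [v *m (F^T *m F) = 0], then [v *m F^T] has zero sum of squares, hence vanishes, and freeness
    gives [v = 0]. *)
Lemma gram_unitmx {m r : nat} (F : 'M[R]_(m, r)) :
  row_free F^T -> F^T *m F \in unitmx.
Proof.
move=> freeF; rewrite -row_free_unit -kermx_eq0; apply/eqP/row_matrixP => i.
rewrite row0; set v := row i _.
have vG : v *m (F^T *m F) = 0 by rewrite /v -row_mul mulmx_ker row0.
apply: (row_free_inj freeF); rewrite mul0mx; apply: sumsq_eq0.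
rewrite sumsq_mxtrace trmx_mul trmxK.
by rewrite mulmxA -(mulmxA v) vG mul0mx mxtrace0.
Qed.

(** [U] may be rank deficient, so [U^T *m U] need not be invertible. With a full-rank factorization
    [U = F *m H], the matrix F (F^T F)^-1 F^T projects onto the column space of [U], and its trace
    is the rank of [U]. *)
Lemma orthogonal_projector {m k : nat} (U : 'M[R]_(m, k)) :
  exists P : 'M[R]_m,
    [/\ P^T = P, P *m P = P, P *m U = U & \tr P <= k%:R].
Proof.
have rk : (\rank U)%:R <= k%:R :> R by rewrite ler_nat rank_leq_col.
move: (col_base U) (row_base U) (mulmx_base U) (col_base_full U).
(* Generalizing the rank frees the types of [F] and [H] from [U], so that [U] can be rewritten as
   [F *m H]. *)
move: (\rank U) rk => r rk F H FH fullF.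
have Gu : F^T *m F \in unitmx by apply: gram_unitmx; rewrite /row_free mxrank_tr.
set G := invmx (F^T *m F).
have GF : G *m (F^T *m F) = 1%:M by rewrite mulVmx.
exists (F *m G *m F^T); split.
- by rewrite !trmx_mul trmxK mulmxA /G trmx_inv trmx_mul trmxK.
- by rewrite -!mulmxA (mulmxA F^T F) (mulmxA G (F^T *m F)) GF mul1mx.
- by rewrite -FH -!mulmxA (mulmxA F^T F) (mulmxA G (F^T *m F)) GF mul1mx.
- by rewrite -mulmxA mxtrace_mulC -mulmxA GF mxtrace1.
Qed.

Lemma sumsq_projector_mul {m n : nat} {P : 'M[R]_m} (A : 'M[R]_(m, n)) :
  P^T = P -> P *m P = P -> sumsq (P *m A) = \tr (P *m (A *m A^T)).
Proof.
move=> symP idP; rewrite sumsq_mxtrace trmx_mul symP (mulmxA (P *m A)) mxtrace_mulC.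
by rewrite -[in LHS]mulmxA (mulmxA P P) idP.
Qed.

Context {m : nat} {P : 'M[R]_m}.
Hypotheses (symP : P^T = P) (idP : P *m P = P).

Lemma projector_compl_sym : (1%:M - P)^T = 1%:M - P.
Proof. by rewrite raddfB /= trmx1 symP. Qed.

Lemma projector_compl_idem : (1%:M - P) *m (1%:M - P) = 1%:M - P.
Proof. by rewrite mulmxBr mulmx1 mulmxBl mul1mx idP subrr subr0. Qed.

(** Pythagoras: both terms are traces against [A *m A^T], and the two projectors add up to the
    identity. *)
Lemma sumsq_projector {n : nat} (A : 'M[R]_(m, n)) :
  sumsq A = sumsq (P *m A) + sumsq ((1%:M - P) *m A).
Proof.
rewrite !sumsq_projector_mul ?projector_compl_sym ?projector_compl_idem //.
by rewrite -raddfD /= -mulmxDl addrC subrK mul1mx sumsq_mxtrace.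
Qed.

(** Since P = P P^T, the entry P_ii is the squared norm of row i, hence at least P_ii^2. *)
Lemma projector_diag (i : 'I_m) : 0 <= P i i <= 1.
Proof.
have Pii : P i i = \sum_j P i j ^+ 2.
  rewrite -{1}idP mxE; apply: eq_bigr => j _.
  by rewrite expr2 -{2}symP mxE.
have ge : P i i ^+ 2 <= P i i.
  rewrite [leRHS]Pii (bigD1 i) //= lerDl.
  by apply: sumr_ge0 => j _; exact: sqr_ge0.
by apply/andP; split; nra.
Qed.

End Projector.

(* Termwise comparison, weighting by the threshold value c = w_(k-1), the k-th
   largest of the w_i. *)
Lemma sum_tail_le_weighted {R : realType} {m k : nat} (w p : 'I_m -> R) :
    (0 < k <= m)%N ->
    (forall i, 0 <= w i) ->
    (forall i j : 'I_m, (i <= j)%N -> w j <= w i) ->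
    (forall i, 0 <= p i <= 1) -> \sum_i p i <= k%:R ->
  \sum_(i < m) (k <= i)%:R * w i <= \sum_(i < m) (1 - p i) * w i.
Proof.
case/andP => k0 km w0 wmono p01 pk.
have k1m : (k.-1 < m)%N by rewrite prednK.
set c := w (Ordinal k1m).
(* The difference of the two sides is the sum of ([i < k] - p_i) w_i. Its first factor has the same
   sign as w_i - c, so replacing w_i by c can only lower each term; what remains is c (k - \sum_i
   p_i), which is nonnegative. *)
suff : 0 <= \sum_(i < m) c * ((i < k)%:R - p i)
   /\ \sum_(i < m) c * ((i < k)%:R - p i)
      <= \sum_(i < m) ((1 - p i) * w i - (k <= i)%:R * w i).
  by case=> h1 h2; rewrite -subr_ge0 -sumrB (le_trans h1).
split.
  rewrite -mulr_sumr mulr_ge0 ?w0 // sumrB subr_ge0 (le_trans pk) //.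
  rewrite -[k in k%:R]card_ord -sum1_card (big_ord_widen m (fun=> 1%N)) //.
  rewrite big_mkcond natr_sum; apply: ler_sum => i _.
  by case: (i < k)%N.
apply: ler_sum => i _; have /andP[p0 p1] := p01 i.
case: (ltnP i k) => ik /=.
  have : c <= w i by apply: wmono; rewrite /= -ltnS prednK.
  nra.
have : w i <= c by apply: wmono; rewrite /= (leq_trans (leq_pred _)).
nra.
Qed.

(** * Lower bound for approximating a singular value matrix *)

Section SingularValues.
Context {R : realType} {m n : nat} {S : 'M[R]_(m, n)}.
Hypothesis svS : singular_value_mx S.

(** The sum over row [i] is s_i^2 when [i < n] and 0 otherwise, which gives a weight to every
    [i : 'I_m] even if [m > n]. *)
Lemma row_sumsq_nonincreasing (i i' : 'I_m) : (i <= i')%N ->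
  \sum_j S i' j ^+ 2 <= \sum_j S i j ^+ 2.
Proof.
move=> ii'; have [S0 Sge0 Smono] := svS.
have [i'n|ni'] := ltnP i' n; last first.
  rewrite big1 => [|j _]; first by apply: sumr_ge0 => j _; exact: sqr_ge0.
  rewrite S0 ?expr0n // => ij; have := ltn_ord j.
  by rewrite -ij ltnNge ni'.
have i_n := leq_ltn_trans ii' i'n.
rewrite (bigD1 (Ordinal i'n)) //= big1 ?addr0 => [|j ji']; last first.
  rewrite S0 ?expr0n // => ij; move/eqP: ji'; apply.
  exact/val_inj.
rewrite (bigD1 (Ordinal i_n)) //= -[leLHS]addr0.
apply: lerD; last by apply: sumr_ge0 => j _; exact: sqr_ge0.
by rewrite ler_sqr ?nnegrE ?Sge0 // Smono.
Qed.

(** [S *m S^T] is diagonal, so only the diagonal of [P] enters the trace. *)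
Lemma mxtrace_mul_singular_value (P : 'M[R]_m) :
  \tr (P *m (S *m S^T)) = \sum_i P i i * \sum_j S i j ^+ 2.
Proof.
have [S0 _ _] := svS.
apply: eq_bigr => i _; rewrite mxE (bigD1 i) //= big1 ?addr0 => [|i' ii'].
  rewrite mxE; congr (_ * _); apply: eq_bigr => j _.
  by rewrite mxE expr2.
rewrite mxE big1 ?mulr0 // => j _; rewrite mxE.
have [ij|/eqP ij] := eqVneq (i : nat) j; last by rewrite [S i j]S0 ?mulr0.
by rewrite [S i' j]S0 ?mul0r // -ij => /val_inj/eqP; apply/negP.
Qed.

Lemma eckart_young {k : nat} (U : 'M[R]_(m, k)) (V : 'M[R]_(k, n)) :
    (0 < k <= m)%N ->
  \sum_(i < m) (k <= i)%:R * (\sum_j S i j ^+ 2) <= sumsq (S - U *m V).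
Proof.
move=> km; have [P [symP idP PU trP]] := orthogonal_projector U.
rewrite (sumsq_projector symP idP).
(* [1%:M - P] annihilates the columns of [U], which removes the dependence on [V]. *)
have -> : (1%:M - P) *m (S - U *m V) = (1%:M - P) *m S.
  by rewrite mulmxBr (mulmxA _ U) (mulmxBl _ _ U) mul1mx PU subrr mul0mx subr0.
rewrite (sumsq_projector_mul _ (projector_compl_sym symP) (projector_compl_idem idP)).
rewrite mxtrace_mul_singular_value.
apply: le_trans (_ : _ <= \sum_i (1 - P i i) * \sum_j S i j ^+ 2) _.
  apply: sum_tail_le_weighted => //.
  - by move=> i; apply: sumr_ge0 => j _; exact: sqr_ge0.
  - exact: row_sumsq_nonincreasing.
  - exact: projector_diag.
under [X in _ + X]eq_bigr => i _ do rewrite !mxE eqxx.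
by rewrite lerDr sumsq_ge0.
Qed.

End SingularValues.

(** * Error of the truncated decomposition *)

Section Truncation.
Context {R : realType}.

(** Column selection becomes a matrix product, so truncations can be rearranged by associativity. *)
Lemma first_cols_mul1 {m n k : nat} (hk : (k <= n)%N) (A : 'M[R]_(m, n)) :
  first_cols hk A = A *m first_cols hk 1%:M.
Proof. by rewrite /first_cols mulmx_colsub mulmx1. Qed.

Lemma sum_widen_delta {n k : nat} (hk : (k <= n)%N) (G : 'I_n -> R)
    (j : 'I_n) :
  \sum_(a < k) G (widen_ord hk a) * (j == widen_ord hk a)%:R
  = (j < k)%:R * G j.
Proof.
have [jk|kj] := ltnP j k; last first.
  rewrite mul0r big1 // => a _; rewrite [_ == _]negbTE ?mulr0 //.
  by apply: contraTneq kj => ->; rewrite -ltnNge /=.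
have jE : j = widen_ord hk (Ordinal jk) by exact: val_inj.
rewrite (bigD1 (Ordinal jk)) //= big1 ?addr0 => [|a aj]; last first.
  rewrite [_ == _]negbTE ?mulr0 //; apply: contra aj => /eqP ja.
  by apply/eqP/val_inj; rewrite /= ja.
by rewrite -jE eqxx mulr1 mul1r.
Qed.

(** The product pads the leading block with zeros back to the size of [S]. *)
Lemma first_cols_sandwich {m n k : nat} (hkm : (k <= m)%N) (hkn : (k <= n)%N)
    (S : 'M[R]_(m, n)) (i : 'I_m) (j : 'I_n) :
  (first_cols hkm 1%:M *m leading_block hkm hkn S
     *m (first_cols hkn 1%:M)^T) i j
  = (j < k)%:R * ((i < k)%:R * S i j).
Proof.
rewrite -(sum_widen_delta hkn (fun j' => (i < k)%:R * S i j')) mxE.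
apply: eq_bigr => b _; rewrite mxE !mxE; congr (_ * _).
rewrite -(sum_widen_delta hkm (fun i' => S i' (widen_ord hkn b))).
by apply: eq_bigr => a _; rewrite !mxE mulrC.
Qed.

Lemma leading_block_tr {m n k : nat} (hkm : (k <= m)%N) (hkn : (k <= n)%N)
    (S : 'M[R]_(m, n)) :
  singular_value_mx S -> (leading_block hkm hkn S)^T = leading_block hkm hkn S.
Proof.
case=> S0 _ _; apply/matrixP => i j; rewrite !mxE.
by have [->//|/eqP ij] := eqVneq i j; rewrite !S0 //= => /val_inj // /esym.
Qed.

(** Off-diagonal entries vanish and the first [k] diagonal ones cancel; what is left equals the
    lower bound of [eckart_young]. *)
Lemma sumsq_truncation {m n k : nat} (hkm : (k <= m)%N) (hkn : (k <= n)%N)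
    (S : 'M[R]_(m, n)) :
  singular_value_mx S ->
  sumsq (S - first_cols hkm 1%:M *m leading_block hkm hkn S
               *m (first_cols hkn 1%:M)^T)
  = \sum_(i < m) (k <= i)%:R * \sum_j S i j ^+ 2.
Proof.
case=> S0 _ _; apply: eq_bigr => i _; rewrite mulr_sumr.
apply: eq_bigr => j _; rewrite mxE [X in _ + X]mxE first_cols_sandwich.
have [ij|/eqP ij] := eqVneq (i : nat) j; last first.
  by rewrite S0 // !mulr0 subrr expr0n mulr0.
rewrite -ij; case: ltnP => _.
  by rewrite !mul1r subrr expr0n mul0r.
by rewrite mul0r subr0 mul1r.
Qed.

End Truncation.

(** * Reduction of the joint problem to a single low-rank approximation *)

Lemma joint_error_row_mx {R : realType} {m n1 n2 k : nat}
    (X : 'M[R]_(m, n1)) (Y : 'M[R]_(m, n2))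
    (U : 'M[R]_(m, k)) (V : 'M[R]_(n1, k)) (W : 'M[R]_(n2, k)) :
  joint_error X Y U V W = sumsq (row_mx X Y - U *m (col_mx V W)^T).
Proof.
rewrite /joint_error !frobenius_norm_sqr -sumsq_row_mx.
by rewrite tr_col_mx mul_mx_row opp_row_mx add_row_mx.
Qed.

Theorem theorem2p1 (R : realType) (m n1 n2 k : nat)
    (X : 'M[R]_(m, n1)) (Y : 'M[R]_(m, n2))
    (hk1 : (1 <= k)%N) (hkm : (k <= m)%N) (hkn : (k <= n1 + n2)%N)
    (Ut : 'M[R]_m) (S : 'M[R]_(m, n1 + n2)) (Vt : 'M[R]_(n1 + n2))
    (hsvd : is_svd (row_mx X Y) Ut S Vt) :
  let Uk := first_cols hkm Ut in
  let Vk := first_cols hkn Vt in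
  let Sk := leading_block hkm hkn S in
  forall (U : 'M[R]_(m, k)) (V : 'M[R]_(n1, k)) (W : 'M[R]_(n2, k)),
    joint_error X Y Uk (usubmx (Vk *m Sk)) (dsubmx (Vk *m Sk))
      <= joint_error X Y U V W.
Proof.
move=> Uk Vk Sk U V W; rewrite !joint_error_row_mx vsubmxK.
have [oU oV svS ->] := hsvd; have [_ UU] := oU; have [_ VV] := oV.
(* Both residuals are put in the form [Ut *m _ *m Vt^T], so that orthogonal invariance leaves only
   the middle factor. Here the symmetry of [Sk] absorbs the transpose. *)
have -> : Ut *m S *m Vt^T - Uk *m (Vk *m Sk)^T
    = Ut *m (S - first_cols hkm 1%:M *m Sk *m (first_cols hkn 1%:M)^T) *m Vt^T.
  rewrite mulmxBr mulmxBl /Uk /Vk (first_cols_mul1 hkm) (first_cols_mul1 hkn Vt).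
  by rewrite !trmx_mul leading_block_tr // !mulmxA.
(* The change of bases keeps the competitor a product with inner dimension [k]. *)
have -> : Ut *m S *m Vt^T - U *m (col_mx V W)^T
    = Ut *m (S - (Ut^T *m U) *m ((col_mx V W)^T *m Vt)) *m Vt^T.
  rewrite mulmxBr mulmxBl -!mulmxA VV mulmx1.
  by rewrite (mulmxA Ut Ut^T) UU mul1mx.
rewrite !sumsq_orthogonal // sumsq_truncation //.
by apply: eckart_young; rewrite // hk1 hkm.
Qed.
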